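(* Let $(A,m,u,\Delta,\varepsilon,\Phi,S)$ be a quasi-bialgebra with preantipode $S$ over a field $\Bbbk$, and let $F=F^1\otimes F^2\in A\otimes A$ be a gauge transformation on $A$, with inverse $F^{-1}=f^1\otimes f^2$. Define, for $a\in A$, $S_F(a):=F^1S(f^1aF^2)f^2$. Then $A_F=(A,m,u,\Delta_F,\varepsilon,\Phi_F)$ together with $S_F$ is a quasi-bialgebra with preantipode $S_F$.
   Context: $\Bbbk$ is a field, $\otimes=\otimes_\Bbbk$; Sweedler notation $\Delta(a)=a_1\otimes a_2$; summation is understood in all expressions such as $F=F^1\otimes F^2$. Quasi-bialgebra: $(A,m,u)$ is an associative unital $\Bbbk$-algebra, $\Delta\colon A\to A\otimes A$ and $\varepsilon\colon A\to\Bbbk$ are algebra maps, $\Phi=\Phi^1\otimes\Phi^2\otimes\Phi^3\in A\otimes A\otimes A$ is invertible, and, writing $A$ for $\mathrm{Id}_A$: $(A\otimes A\otimes\Delta)(\Phi)\cdot(\Delta\otimes A\otimes A)(\Phi)=(1\otimes\Phi)\cdot(A\otimes\Delta\otimes A)(\Phi)\cdot(\Phi\otimes1)$; $(\varepsilon\otimes A\otimes A)(\Phi)=(A\otimes\varepsilon\otimes A)(\Phi)=(A\otimes A\otimes\varepsilon)(\Phi)=1\otimes1$; $(A\otimes\Delta)(\Delta(a))\cdot\Phi=\Phi\cdot(\Delta\otimes A)(\Delta(a))$; $\varepsilon(a_1)a_2=a=a_1\varepsilon(a_2)$ for all $a\in A$. A preantipode for $A$ is a $\Bbbk$-linear map $S\colon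 A\to A$ such that, for all $a,b\in A$, $a_1S(ba_2)=\varepsilon(a)S(b)$, $S(a_1b)a_2=\varepsilon(a)S(b)$, and $\Phi^1S(\Phi^2)\Phi^3=1$. A gauge transformation on $A$ is an invertible element $F\in A\otimes A$ with $(A\otimes\varepsilon)(F)=1=(\varepsilon\otimes A)(F)$. The twist of $A$ via $F$ is the quasi-bialgebra $A_F=(A,m,u,\Delta_F,\varepsilon,\Phi_F)$ with $\Delta_F(a)=F\cdot\Delta(a)\cdot F^{-1}$ and $\Phi_F=(1\otimes F)\cdot(A\otimes\Delta)(F)\cdot\Phi\cdot(\Delta\otimes A)(F^{-1})\cdot(F^{-1}\otimes1)$. *)

(* Defs.v *)
From HB Require Import structures.
From mathcomp Require Import all_boot all_order all_algebra.
From mathcomp Require Import boolp classical_sets.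

Set Implicit Arguments.
Unset Strict Implicit.
Unset Printing Implicit Defensive.

Import GRing.Theory.
Local Open Scope ring_scope.
Local Open Scope quotient_scope.

Reserved Notation "U ⊗ V" (at level 39, left associativity).

Definition bilin (k : fieldType) (U V W : lmodType k) (f : U -> V -> W) : Prop :=
  (forall v, linear (f^~ v)) /\ (forall u, linear (f u)).

(* The tensor product over k: formal sums of pairs, read as seq (U * V), modulo
   the least additive congruence that makes pairs bilinear and balanced.
   Scalars act on the first component, so no formal coefficients are needed. *)
Section TensorModule.
Variable k : fieldType.

Section Congruence.
Variables U V : lmodType k.

Inductive tensor_rel : seq (U * V) -> seq (U * V) -> Prop :=
  | tensor_refl s : tensor_rel s s
  | tensor_sym s t : tensor_rel s t -> tensor_rel t s
  | tensor_trans s t r : tensor_rel s t -> tensor_rel t r -> tensor_rel s r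
  | tensor_cat s s' t t' :
      tensor_rel s t -> tensor_rel s' t' -> tensor_rel (s ++ s') (t ++ t')
  | tensor_catC s t : tensor_rel (s ++ t) (t ++ s)
  | tensor_0l v : tensor_rel [:: (0, v)] [::]
  | tensor_Dl u u' v : tensor_rel [:: (u + u', v)] [:: (u, v); (u', v)]
  | tensor_Dr u v v' : tensor_rel [:: (u, v + v')] [:: (u, v); (u, v')]
  | tensor_Z a u v : tensor_rel [:: (a *: u, v)] [:: (u, a *: v)].

Definition tensor_relb : rel (seq (U * V)) := fun s t => `[< tensor_rel s t >].

Lemma tensor_relb_equiv : equiv_class_of tensor_relb.
Proof.
split=> [s|s t|t s r].
- exact/asboolP/tensor_refl.
- by apply/asboolP/asboolP; exact: tensor_sym.
- by move=> /asboolP st /asboolP tr; apply/asboolP; exact: tensor_trans tr.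
Qed.

Canonical tensor_equiv := EquivRelPack tensor_relb_equiv.

Definition tensor := {eq_quot tensor_equiv}.

HB.instance Definition _ : EqQuotient _ tensor_equiv tensor :=
  EqQuotient.on tensor.
HB.instance Definition _ := Choice.on tensor.

Definition tensor_pi (s : seq (U * V)) : tensor := \pi_tensor s.

Lemma tensor_piP s t : tensor_rel s t <-> tensor_pi s = tensor_pi t.
Proof.
split=> [st|/eqmodP/asboolP//].
by apply/eqmodP/asboolP.
Qed.

Lemma tensor_piK (t : tensor) : tensor_pi (repr t) = t.
Proof. exact: reprK. Qed.

Lemma tensor_rel_repr s : tensor_rel (repr (tensor_pi s)) s.
Proof. by apply/tensor_piP; rewrite tensor_piK. Qed.

Definition tensor_add (t t' : tensor) : tensor := tensor_pi (repr t ++ repr t').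
Definition tensor_scale (a : k) (t : tensor) : tensor :=
  tensor_pi [seq (a *: p.1, p.2) | p <- repr t].
Definition tensor_opp : tensor -> tensor := tensor_scale (-1).

Lemma tensor_addE s s' :
  tensor_add (tensor_pi s) (tensor_pi s') = tensor_pi (s ++ s').
Proof. by apply/tensor_piP/tensor_cat; exact: tensor_rel_repr. Qed.

Lemma tensor_map_scale a s t : tensor_rel s t ->
  tensor_rel [seq (a *: p.1, p.2) | p <- s] [seq (a *: p.1, p.2) | p <- t].
Proof.
elim=> {s t} /= [s|s t _|s t r _ + _|s s' t t' _ + _|s t|v|u u' v|u v v'|b u v].
- exact: tensor_refl.
- exact: tensor_sym.
- exact: tensor_trans.
- by rewrite !map_cat; exact: tensor_cat.
- by rewrite !map_cat; exact: tensor_catC.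
- by rewrite scaler0; exact: tensor_0l.
- by rewrite scalerDr; exact: tensor_Dl.
- exact: tensor_Dr.
- by rewrite scalerA mulrC -scalerA; exact: tensor_Z.
Qed.

Lemma tensor_scaleE a s :
  tensor_scale a (tensor_pi s) = tensor_pi [seq (a *: p.1, p.2) | p <- s].
Proof. by apply/tensor_piP/tensor_map_scale; exact: tensor_rel_repr. Qed.

Lemma tensor_addA : associative tensor_add.
Proof.
move=> x y z; rewrite -[x]tensor_piK -[y]tensor_piK -[z]tensor_piK.
by rewrite !tensor_addE catA.
Qed.

Lemma tensor_addC : commutative tensor_add.
Proof. by move=> x y; apply/tensor_piP; exact: tensor_catC. Qed.

Lemma tensor_add0 : left_id (tensor_pi [::]) tensor_add.
Proof. by move=> x; rewrite -[x]tensor_piK tensor_addE. Qed.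

Lemma tensor_scaleDl t : {morph tensor_scale^~ t : a b / a + b >-> tensor_add a b}.
Proof.
move=> a b; rewrite -[t]tensor_piK !tensor_scaleE tensor_addE.
have consE p s : tensor_pi (p :: s) = tensor_add (tensor_pi [:: p]) (tensor_pi s).
  by rewrite tensor_addE.
elim: (repr t) => [//|[u v] s IH] /=; rewrite scalerDl.
have {1}-> := consE (_ + _, v); rewrite IH.
rewrite (consE (a *: u, v)) -!tensor_addE (consE (b *: u, v)).
have -> : tensor_pi [:: (a *: u + b *: u, v)] =
  tensor_add (tensor_pi [:: (a *: u, v)]) (tensor_pi [:: (b *: u, v)]).
  by rewrite tensor_addE; apply/tensor_piP; exact: tensor_Dl.
rewrite -!tensor_addA; congr tensor_add.
by rewrite !tensor_addA; congr tensor_add; exact: tensor_addC.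
Qed.

Lemma tensor_addN : left_inverse (tensor_pi [::]) tensor_opp tensor_add.
Proof.
have scale1 t : tensor_scale 1 t = t.
  rewrite -[t in RHS]tensor_piK /tensor_scale; congr tensor_pi.
  by rewrite -[RHS]map_id; apply: eq_map => -[u v] /=; rewrite scale1r.
move=> t; rewrite -{2}[t]scale1 -tensor_scaleDl addNr.
rewrite -[t]tensor_piK tensor_scaleE; elim: (repr t) => [//|[u v] s IH] /=.
rewrite -cat1s -tensor_addE IH scale0r tensor_addC tensor_add0.
by apply/tensor_piP; exact: tensor_0l.
Qed.

HB.instance Definition _ := GRing.isZmodule.Build tensor
  tensor_addA tensor_addC tensor_add0 tensor_addN.

Lemma tensor_scaleA a b t :
  tensor_scale a (tensor_scale b t) = tensor_scale (a * b) t.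
Proof.
rewrite -[t]tensor_piK !tensor_scaleE -map_comp; congr tensor_pi.
by apply: eq_map => -[u v] /=; rewrite scalerA.
Qed.

Lemma tensor_scale1 : left_id 1 tensor_scale.
Proof.
move=> t; rewrite -[t in RHS]tensor_piK /tensor_scale; congr tensor_pi.
by rewrite -[RHS]map_id; apply: eq_map => -[u v] /=; rewrite scale1r.
Qed.

Lemma tensor_scaleDr : right_distributive tensor_scale +%R.
Proof.
move=> a x y; rewrite -[x]tensor_piK -[y]tensor_piK.
by rewrite /GRing.add /= tensor_addE !tensor_scaleE tensor_addE map_cat.
Qed.

HB.instance Definition _ := GRing.Zmodule_isLmodule.Build k tensor
  tensor_scaleA tensor_scale1 tensor_scaleDr tensor_scaleDl.

Lemma tensor_piD s s' : tensor_pi s + tensor_pi s' = tensor_pi (s ++ s').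
Proof. exact: tensor_addE. Qed.

Lemma tensor_piZ a s :
  a *: tensor_pi s = tensor_pi [seq (a *: p.1, p.2) | p <- s].
Proof. exact: tensor_scaleE. Qed.

End Congruence.

Local Notation "U ⊗ V" := (tensor U%type V%type) : type_scope.

Definition tens (U V : lmodType k) (u : U) (v : V) : U ⊗ V :=
  tensor_pi [:: (u, v)].
Local Notation "u ⊗ v" := (tens u v) : ring_scope.

(* tlift f (u1 ⊗ v1 + ... + un ⊗ vn) = f u1 v1 + ... + f un vn; the value does
   not depend on the chosen representative as soon as f is bilinear (tlift_pi),
   which is the only case in which this operation is meaningful. *)
Definition tlift (U V W : lmodType k) (f : U -> V -> W) (t : U ⊗ V) : W :=
  \sum_(p <- repr t) f p.1 p.2.

Section Universal.
Variables U V : lmodType k.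

Lemma tens_bilin : bilin (@tens U V).
Proof.
split=> [v a u u'|u a v v'].
- rewrite /tens tensor_piZ tensor_piD.
  exact/tensor_piP/tensor_Dl.
- rewrite /tens tensor_piZ tensor_piD.
  apply/tensor_piP; apply: tensor_trans (tensor_Dr _ _ _) _.
  rewrite -cat1s; apply: tensor_cat; last exact: tensor_refl.
  exact/tensor_sym/tensor_Z.
Qed.

Lemma tensor_pi_sum (s : seq (U * V)) :
  tensor_pi s = \sum_(p <- s) (p.1 ⊗ p.2).
Proof.
elim: s => [|[u v] s IH]; first by rewrite big_nil.
by rewrite big_cons -IH tensor_piD.
Qed.

Lemma tensor_sumE (t : U ⊗ V) : t = \sum_(p <- repr t) (p.1 ⊗ p.2).
Proof. by rewrite -tensor_pi_sum tensor_piK. Qed.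

Variable W : lmodType k.

Lemma tlift_pi (f : U -> V -> W) (s : seq (U * V)) : bilin f ->
  tlift f (tensor_pi s) = \sum_(p <- s) f p.1 p.2.
Proof.
move=> [fl fr]; rewrite /tlift.
suff sumE s1 s2 : tensor_rel s1 s2 ->
    \sum_(p <- s1) f p.1 p.2 = \sum_(p <- s2) f p.1 p.2.
  exact/sumE/tensor_rel_repr.
elim=> {s s1 s2} //=.
- by move=> s t r _ -> _ ->.
- by move=> s s' t t' _ IH _ IH'; rewrite !big_cat /= IH IH'.
- by move=> s t; rewrite !big_cat /= addrC.
- move=> v; rewrite big_seq1 big_nil /=.
  by have := fl v (-1) 0 0; rewrite scaleN1r oppr0 addr0 scaleN1r addNr.
- move=> u u' v; rewrite big_seq1 !big_cons big_nil addr0 /=.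
  by have := fl v 1 u u'; rewrite !scale1r.
- move=> u v v'; rewrite big_seq1 !big_cons big_nil addr0 /=.
  by have := fr u 1 v v'; rewrite !scale1r.
- move=> a u v; rewrite !big_seq1 /=.
  have f0l : f 0 v = 0.
    by have := fl v (-1) 0 0; rewrite scaleN1r oppr0 addr0 scaleN1r addNr.
  have f0r : f u 0 = 0.
    by have := fr u (-1) 0 0; rewrite scaleN1r oppr0 addr0 scaleN1r addNr.
  by have := fl v a u 0; have := fr u a v 0; rewrite !addr0 f0l f0r !addr0 => -> ->.
Qed.

Lemma tlift_tens (f : U -> V -> W) u v : bilin f -> tlift f (u ⊗ v) = f u v.
Proof. by move=> fb; rewrite tlift_pi // big_seq1. Qed.

Lemma tlift_linear (f : U -> V -> W) : bilin f -> linear (tlift f).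
Proof.
move=> fb a t t'; rewrite -[t]tensor_piK -[t']tensor_piK.
rewrite tensor_piZ tensor_piD !tlift_pi // big_cat big_map /=.
rewrite scaler_sumr; congr (_ + _); apply: eq_bigr => -[u v] _ /=.
have f0l : f 0 v = 0.
  by have := fb.1 v (-1) 0 0; rewrite scaleN1r oppr0 addr0 scaleN1r addNr.
by have := fb.1 v a u 0; rewrite !addr0 f0l addr0.
Qed.

Lemma tensor_linear_ext (g h : U ⊗ V -> W) : linear g -> linear h ->
  (forall u v, g (u ⊗ v) = h (u ⊗ v)) -> g =1 h.
Proof.
move=> gl hl gh t; rewrite (tensor_sumE t).
have l0 (f : U ⊗ V -> W) : linear f -> f 0 = 0.
  by move=> fl; have := fl (-1) 0 0; rewrite scaleN1r oppr0 addr0 scaleN1r addNr.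
elim: (repr t) => [|p s IH]; first by rewrite !big_nil !l0.
have := gl 1 (p.1 ⊗ p.2) (\sum_(p <- s) (p.1 ⊗ p.2)).
have := hl 1 (p.1 ⊗ p.2) (\sum_(p <- s) (p.1 ⊗ p.2)).
by rewrite big_cons !scale1r IH gh => -> ->.
Qed.

End Universal.

Lemma tlift_fun_linear (U V W : lmodType k) (f g h : U -> V -> W) a t :
  (forall u v, h u v = a *: f u v + g u v) ->
  tlift h t = a *: tlift f t + tlift g t.
Proof.
move=> hE; rewrite /tlift scaler_sumr -big_split /=.
by apply: eq_bigr => p _; exact: hE.
Qed.

(* Used only to show that a tensor product of nonzero algebras is nonzero,
   which algType requires. *)
Lemma linear_functional (V : lmodType k) (v : V) : v != 0 ->
  exists2 phi : V -> k^o, linear phi & phi v = 1.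
Proof.
move=> v0; pose T := (V * k^o)%type.
pose good (G : set T) := [/\ G (v, 1), forall a p q, G p -> G q -> G (a *: p + q)
  & forall c, G (0, c) -> c = 0].
pose P (G : set T) := G = classical_sets.set0 \/ good G.
have [F FP Ftot|M [MP Mmax]] := @Zorn_bigcup T P.
  have [[X FX [p Xp]]|F0] := pselect (exists2 X, F X & (X !=set0)%classic); last first.
    left; apply/seteqP; split=> [p [X FX Xp]|//].
    by case: F0; exists X => //; exists p.
  have goodF Y q : F Y -> Y q -> good Y.
    by move=> FY Yq; case: (FP Y FY) => // Y0; move: Yq; rewrite Y0.
  right; split.
  - by exists X => //; have [] := goodF X p FX Xp.
  - move=> a q r [Y FY Yq] [Z FZ Zr].
    have [_ clY _] := goodF Y q FY Yq; have [_ clZ _] := goodF Z r FZ Zr.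
    have [YZ|ZY] := Ftot Y Z FY FZ.
    + by exists Z => //; apply: clZ => //; exact: YZ.
    + by exists Y => //; apply: clY => //; exact: ZY.
  - by move=> c [Y FY Y0c]; have [_ _] := goodF Y _ FY Y0c; exact.
have [Mv Mcl M0] : good M.
  case: MP => // ME; case: (Mmax [set p | exists a, p = a *: ((v, 1) : T)]%classic).
    rewrite ME; split=> [//|/(_ (v, 1))[]]; by exists 1; rewrite scale1r.
  right; split.
  - by exists 1; rewrite scale1r.
  - move=> a _ _ [b ->] [c ->]; exists (a * b + c).
    by rewrite scalerA scalerDl.
  - move=> c [a [/esym/eqP]]; rewrite scaler_eq0 (negPf v0) orbF => /eqP -> ->.
    by rewrite scale0r.
have M00 : M 0 by have := Mcl (-1) _ _ Mv Mv; rewrite scaleN1r addNr.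
have Muniq x c d : M (x, c) -> M (x, d) -> c = d.
  move=> Mc Md; apply/esym/subr0_eq/M0.
  have := Mcl (-1) _ _ Mc Md; rewrite scaleN1r.
  by rewrite (_ : - (x, c) + (x, d) = (0, d - c)) //; congr pair; rewrite ?addNr // addrC.
have Mtot x : exists c, M (x, c).
  apply: contrapT => Nx.
  pose G : set T := [set p | exists a q, M q /\ p = a *: ((x, 0) : T) + q]%classic.
  case: (Mmax G).
    split=> [p Mp|GM]; first by exists 0, p; rewrite scale0r add0r.
    by apply: Nx; exists 0; apply: GM; exists 1, 0; rewrite scale1r addr0.
  right; split.
  - by exists 0, (v, 1); rewrite scale0r add0r.
  - move=> a _ _ [b [q [Mq ->]]] [c [r [Mr ->]]].
    exists (a * b + c), (a *: q + r); split; first exact: Mcl.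
    by rewrite scalerDr scalerDl scalerA addrACA.
  - move=> c [a [[y d] [My [/esym axy ->]]]].
    have [a0|a0] := eqVneq a 0.
      move: axy My; rewrite a0 scale0r add0r scale0r add0r => -> .
      exact: M0.
    case: Nx; exists (- a^-1 * d).
    have := Mcl (- a^-1) _ _ My M00; rewrite addr0.
    rewrite (_ : - a^-1 *: (y, d) = (x, - a^-1 * d)) //; congr pair.
    move/eqP: axy; rewrite addrC addr_eq0 => /eqP ->.
    by rewrite scalerN scaleNr opprK scalerA mulVf // scale1r.
have [phi Mphi] := choice Mtot.
exists phi; last exact: Muniq (Mphi v) Mv.
move=> a x y; apply: Muniq (Mphi _) _.
exact: (Mcl a _ _ (Mphi x) (Mphi y)).
Qed.

End TensorModule.

Notation "U ⊗ V" := (tensor U%type V%type) : type_scope.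
Notation "u ⊗ v" := (tens u v) : ring_scope.

Section TensorAlgebra.
Variables (k : fieldType) (A B : algType k).
Implicit Types t : A ⊗ B.

Definition tensor_mul t t' : A ⊗ B :=
  tlift (fun a b => tlift (fun a' b' => (a * a') ⊗ (b * b')) t') t.

Lemma tensor_mul_bilin2 a b :
  bilin (fun (a' : A) (b' : B) => (a * a') ⊗ (b * b')).
Proof.
split=> [b' c x y|a' c x y] /=.
- by rewrite mulrDr -scalerAr (tens_bilin _ _).1.
- by rewrite mulrDr -scalerAr (tens_bilin _ _).2.
Qed.

Lemma tensor_mul_bilin1 t' :
  bilin (fun (a : A) (b : B) => tlift (fun a' b' => (a * a') ⊗ (b * b')) t').
Proof.
split=> [b c x y|a c x y] /=; apply: tlift_fun_linear => a' b'.
- by rewrite mulrDl -scalerAl (tens_bilin _ _).1.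
- by rewrite mulrDl -scalerAl (tens_bilin _ _).2.
Qed.

Lemma tensor_mul_tens a b a' b' :
  tensor_mul (a ⊗ b) (a' ⊗ b') = (a * a') ⊗ (b * b').
Proof.
rewrite /tensor_mul tlift_tens; last exact: tensor_mul_bilin1.
by rewrite tlift_tens //; exact: tensor_mul_bilin2.
Qed.

Lemma tensor_mul_linl t' : linear (tensor_mul^~ t').
Proof. by apply: tlift_linear; exact: tensor_mul_bilin1. Qed.

Lemma tensor_mul_linr t : linear (tensor_mul t).
Proof.
move=> c x y; apply: tlift_fun_linear => a b.
by rewrite tlift_linear //; exact: tensor_mul_bilin2.
Qed.

Lemma tensor_mulA : associative tensor_mul.
Proof.
move=> x y z; move: x; apply: tensor_linear_ext => [c x x'|c x x'|a b] /=.
- by rewrite tensor_mul_linl.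
- by rewrite !tensor_mul_linl.
move: y; apply: tensor_linear_ext => [c x x'|c x x'|a' b'] /=.
- by rewrite tensor_mul_linl tensor_mul_linr.
- by rewrite tensor_mul_linr tensor_mul_linl.
move: z; apply: tensor_linear_ext => [c x x'|c x x'|a'' b''] /=.
- by rewrite !tensor_mul_linr.
- by rewrite tensor_mul_linr.
by rewrite !tensor_mul_tens !mulrA.
Qed.

Lemma tensor_mul1 : left_id (1 ⊗ 1) tensor_mul.
Proof.
apply: tensor_linear_ext => [c x x'|c x x'|a b] //=.
- by rewrite tensor_mul_linr.
- by rewrite tensor_mul_tens !mul1r.
Qed.

Lemma tensor_mulr1 : right_id (1 ⊗ 1) tensor_mul.
Proof.
apply: tensor_linear_ext => [c x x'|c x x'|a b] //=.
- by rewrite tensor_mul_linl.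
- by rewrite tensor_mul_tens !mulr1.
Qed.

Lemma tensor_mulDl : left_distributive tensor_mul +%R.
Proof. by move=> x y z; have := tensor_mul_linl z 1 x y; rewrite !scale1r. Qed.

Lemma tensor_mulDr : right_distributive tensor_mul +%R.
Proof. by move=> x y z; have := tensor_mul_linr x 1 y z; rewrite !scale1r. Qed.

Lemma tensor_1_neq0 : (1 : A) ⊗ (1 : B) != 0.
Proof.
have [f fl f1] := linear_functional (oner_neq0 A).
have [g gl g1] := linear_functional (oner_neq0 B).
have fgb : bilin (fun a b => f a * g b : k^o).
  split=> [b c x y|a c x y] /=.
  - by rewrite fl mulrDl -scalerAl.
  - by rewrite gl mulrDr -scalerAr.
apply/eqP => /(congr1 (tlift (fun a b => f a * g b : k^o))).
rewrite tlift_tens // f1 g1 mulr1 -[0 in RHS](scale0r 0).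
rewrite -[X in tlift _ X]addr0 tlift_linear // scale0r add0r.
have := tlift_linear fgb (-1) 0 0.
rewrite scaleN1r oppr0 addr0 scaleN1r addNr => -> /eqP.
by rewrite oner_eq0.
Qed.

HB.instance Definition _ := GRing.Zmodule_isNzRing.Build (tensor A B)
  tensor_mulA tensor_mul1 tensor_mulr1 tensor_mulDl tensor_mulDr tensor_1_neq0.

Lemma tensor_scaleAl (c : k) t t' : c *: (t * t') = (c *: t) * t'.
Proof.
have := tensor_mul_linl t' c t 0; rewrite addr0 => /esym.
by rewrite -[tensor_mul 0 t']/(0 * t') mul0r addr0.
Qed.

Lemma tensor_scaleAr (c : k) t t' : c *: (t * t') = t * (c *: t').
Proof.
have := tensor_mul_linr t c t' 0; rewrite addr0 => /esym.
by rewrite -[tensor_mul t 0]/(t * 0) mulr0 addr0.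
Qed.

HB.instance Definition _ := GRing.Lmodule_isLalgebra.Build k (tensor A B)
  tensor_scaleAl.
HB.instance Definition _ := GRing.Lalgebra_isAlgebra.Build k (tensor A B)
  tensor_scaleAr.

Lemma tensM (a a' : A) (b b' : B) :
  (a ⊗ b) * (a' ⊗ b') = (a * a') ⊗ (b * b').
Proof. exact: tensor_mul_tens. Qed.

Lemma tens1 : (1 : A) ⊗ (1 : B) = 1.
Proof. by []. Qed.

End TensorAlgebra.

Definition tmap (k : fieldType) (U V U' V' : lmodType k)
    (f : U -> U') (g : V -> V') : U ⊗ V -> U' ⊗ V' :=
  tlift (fun u v => f u ⊗ g v).

(* The canonical isomorphism; threefold and fourfold tensor powers are
   bracketed to the right throughout. *)
Definition tassoc (k : fieldType) (U V W : lmodType k) :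
    (U ⊗ V) ⊗ W -> U ⊗ (V ⊗ W) :=
  tlift (fun t w => tlift (fun u v => u ⊗ (v ⊗ w)) t).

(* eps ⊗ U and U ⊗ eps followed by the identifications k ⊗ U = U = U ⊗ k. *)
Definition tcounitl (k : fieldType) (A U : lmodType k) (eps : A -> k) :
    A ⊗ U -> U :=
  tlift (fun a u => eps a *: u).
Definition tcounitr (k : fieldType) (A U : lmodType k) (eps : A -> k) :
    U ⊗ A -> U :=
  tlift (fun u a => eps a *: u).

Definition invertible (R : nzRingType) (x : R) : Prop :=
  exists y, x * y = 1 /\ y * x = 1.

Definition algebra_map (k : fieldType) (A B : algType k) (f : A -> B) : Prop :=
  linear f /\ monoid_morphism f.

Section QuasiBialgebra.
Variables (k : fieldType) (A : algType k).
Implicit Types (Delta : A -> A ⊗ A) (eps : A -> k) (Phi : A ⊗ (A ⊗ A)).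
Implicit Types (S : A -> A) (F Finv : A ⊗ A).

Record quasi_bialgebra Delta eps Phi : Prop := QuasiBialgebra {
  comult_algebra_map : algebra_map Delta;
  counit_algebra_map : algebra_map (eps : A -> k^o);
  reassociator_invertible : invertible Phi;
  reassociator_pentagon :
    tmap id (tmap id Delta) Phi * tassoc (tmap Delta id Phi) =
    (1 ⊗ Phi) * tmap id (@tassoc _ _ _ _ \o tmap Delta id) Phi
      * tmap id (@tassoc _ _ _ _) (tassoc (Phi ⊗ 1));
  reassociator_counit1 : tcounitl eps Phi = 1 ⊗ 1;
  reassociator_counit2 : tmap id (tcounitl eps) Phi = 1 ⊗ 1;
  reassociator_counit3 : tmap id (tcounitr eps) Phi = 1 ⊗ 1;
  quasi_coassociativity : forall a,
    tmap id Delta (Delta a) * Phi = Phi * tassoc (tmap Delta id (Delta a));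
  left_counit : forall a, tcounitl eps (Delta a) = a;
  right_counit : forall a, tcounitr eps (Delta a) = a
}.

Record preantipode Delta eps Phi S : Prop := Preantipode {
  preantipode_linear : linear S;
  preantipodel : forall a b,
    tlift (fun a1 a2 => a1 * S (b * a2)) (Delta a) = eps a *: S b;
  preantipoder : forall a b,
    tlift (fun a1 a2 => S (a1 * b) * a2) (Delta a) = eps a *: S b;
  preantipode_reassociator :
    tlift (fun p1 t => tlift (fun p2 p3 => p1 * S p2 * p3) t) Phi = 1
}.

Record gauge_transformation eps F Finv : Prop := GaugeTransformation {
  gauge_mulV : F * Finv = 1;
  gauge_Vmul : Finv * F = 1;
  gauge_counitr : tcounitr eps F = 1;
  gauge_counitl : tcounitl eps F = 1
}.

Definition twist_comult F Finv Delta : A -> A ⊗ A :=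
  fun a => F * Delta a * Finv.

Definition twist_reassociator F Finv Delta Phi : A ⊗ (A ⊗ A) :=
  (1 ⊗ F) * tmap id Delta F * Phi * tassoc (tmap Delta id Finv)
    * tassoc (Finv ⊗ 1).

Definition twist_preantipode F Finv S : A -> A :=
  fun a => tlift (fun x y =>
    tlift (fun x' y' => x * S (x' * a * y) * y') Finv) F.

End QuasiBialgebra.

(* Main.v *)
From HB Require Import structures.
Require Import Defs.
From mathcomp Require Import all_boot all_order all_algebra.

(** The two halves of the statement are both cancellations, once the right
    viewpoint is chosen.

    Quasi-bialgebra.  Write di for the coface maps A^n -> A^(n+1), where d0 and
    the last one insert a unit in front or behind and the ones in between apply
    Delta to one tensor factor.  All of them are algebra maps, and
    Phi_F = d0 F * d2 F * Phi * d1 F^-1 * d3 F^-1.  They satisfy the cosimplicial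
    identities exactly, except that d3 d2 = d2 d2 and d2 d1 = d1 d1 on A ⊗ A hold
    only up to conjugation by d0 Phi and d4 Phi: this is quasi-coassociativity.
    Moreover the coface maps of the twist are those of A conjugated by F placed
    on the factors where Delta was applied (twist_comult1, tmap_conj).  Expanding
    the pentagon for Phi_F, every factor coming from F either cancels against a
    neighbour or is moved past Phi, and the pentagon for Phi remains.  The
    remaining computation only uses a handful of relations between elements of
    one ring and is isolated in twisted_pentagon_word.  The counit axioms for
    Phi_F follow in the same way, since the counit maps are algebra maps that
    send each of the five factors to F, F^-1, or 1.

    Preantipode.  Linear endomorphisms of A carry commuting actions of A ⊗ A on
    the left and on the right, (p . S . q)(a) = p1 S(q1 a p2) q2, and
    S_F = F . S . F^-1 (twist_preantipodeM).  The first two preantipode axioms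
    say that Delta(a) . S and S . Delta(a) are both eps(a) S; for Delta_F these
    become F Delta(a) F^-1 . F . S . F^-1 = F . (Delta(a) . S) . F^-1 and its
    mirror image.  For the last axiom, let contract S (x ⊗ y ⊗ z) = x S(y) z.
    Acting on S by p and q amounts to multiplying the argument by p ⊗ 1 and
    1 ⊗ q, so the outer factors of Phi_F cancel; the remaining factors
    (A ⊗ Delta)(F) and (Delta ⊗ A)(F^-1) contract to the counits of F and F^-1,
    which are 1. *)

Set Implicit Arguments.
Unset Strict Implicit.
Unset Printing Implicit Defensive.

Import GRing.Theory.
Local Open Scope ring_scope.

(** * Linear maps out of tensor products *)

Section LinearMaps.
Variable k : fieldType.
Implicit Types U V W : lmodType k.

Lemma tlift_ext U V W (f g : U -> V -> W) t :
  (forall u v, f u v = g u v) -> tlift f t = tlift g t.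
Proof. by move=> fg; apply: eq_bigr => p _; exact: fg. Qed.

HB.instance Definition _ U V (u : U) := GRing.isLinear.Build k _ _ _
  (@tens k U V u) ((tens_bilin U V).2 u).

Lemma linear_tensl U V (v : V) : linear (fun u : U => u ⊗ v).
Proof. exact: (tens_bilin U V).1. Qed.

Lemma tensZl U V c (u : U) (v : V) : (c *: u) ⊗ v = c *: (u ⊗ v).
Proof. exact: (GRing.scalable_linear (linear_tensl v)). Qed.

Lemma tmap_bilin U V U' V' (f : {linear U -> U'}) (g : {linear V -> V'}) :
  bilin (fun u v => f u ⊗ g v).
Proof.
by split=> [v|u] a x y /=; rewrite linearP; [exact: linear_tensl | exact: linearP].
Qed.

Lemma tmap_linear U V U' V' (f : {linear U -> U'}) (g : {linear V -> V'}) :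
  linear (tmap f g).
Proof. exact/tlift_linear/tmap_bilin. Qed.

HB.instance Definition _ U V U' V' (f : {linear U -> U'}) (g : {linear V -> V'}) :=
  GRing.isLinear.Build k _ _ _ (tmap f g) (tmap_linear f g).

Lemma tmap_tens U V U' V' (f : {linear U -> U'}) (g : {linear V -> V'}) u v :
  tmap f g (u ⊗ v) = f u ⊗ g v.
Proof. exact/tlift_tens/tmap_bilin. Qed.

Lemma tassoc_inner_bilin U V W (w : W) :
  bilin (fun (u : U) (v : V) => u ⊗ (v ⊗ w)).
Proof. by split=> [v|u] a x y; rewrite ?linear_tensl ?linearP. Qed.

Lemma tassoc_bilin U V W :
  bilin (fun (t : (U ⊗ V)%type) (w : W) => tlift (fun u v => u ⊗ (v ⊗ w)) t).
Proof.
split=> [w|t] a x y; first by apply: tlift_linear; exact: tassoc_inner_bilin.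
by apply: tlift_fun_linear => u v; rewrite !linearP.
Qed.

HB.instance Definition _ U V W := GRing.isLinear.Build k _ _ _
  (@tassoc k U V W) (tlift_linear (tassoc_bilin U V W)).

Lemma tassoc_tens U V W (u : U) (v : V) (w : W) :
  tassoc ((u ⊗ v) ⊗ w) = u ⊗ (v ⊗ w).
Proof.
rewrite /tassoc tlift_tens; last exact: tassoc_bilin.
by rewrite tlift_tens //; exact: tassoc_inner_bilin.
Qed.

Variables (A : lmodType k) (eps : {linear A -> k^o}).

Lemma tcounitl_bilin U : bilin (fun a (u : U) => (eps a : k) *: u).
Proof.
split=> [u|a] c x y; last by rewrite linearP.
by rewrite linearP scalerDl scalerA.
Qed.

Lemma tcounitr_bilin U : bilin (fun (u : U) a => (eps a : k) *: u).
Proof. by have [l r] := tcounitl_bilin U. Qed.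

HB.instance Definition _ U := GRing.isLinear.Build k _ _ _
  (@tcounitl k A U eps) (tlift_linear (tcounitl_bilin U)).
HB.instance Definition _ U := GRing.isLinear.Build k _ _ _
  (@tcounitr k A U eps) (tlift_linear (tcounitr_bilin U)).

Lemma tcounitl_tens U a (u : U) : tcounitl eps (a ⊗ u) = (eps a : k) *: u.
Proof. exact/tlift_tens/tcounitl_bilin. Qed.

Lemma tcounitr_tens U a (u : U) : tcounitr eps (u ⊗ a) = (eps a : k) *: u.
Proof. exact/tlift_tens/tcounitr_bilin. Qed.

End LinearMaps.

(** Two linear maps agree as soon as they agree on pure tensors; the linearity
    side goals are solved by pushing everything outwards. *)
Ltac linear_in_tensor :=
  by move=> ? ? ? /=;
     do ?(rewrite (linear_tensl, linearP, mulrDl, mulrDr,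
                   =^~ scalerAl, =^~ scalerAr) /=).
Tactic Notation "tensor_ind" ident(u) ident(v) :=
  apply: tensor_linear_ext;
    [linear_in_tensor | linear_in_tensor | move=> u v /=].

(** * Algebra maps between tensor products *)

Section AlgebraMaps.
Variable k : fieldType.
Implicit Types A B C : algType k.

Lemma tmap_monoid_morphism A B A' B' (f : {lrmorphism A -> A'})
  (g : {lrmorphism B -> B'}) : monoid_morphism (tmap f g).
Proof.
split; first by rewrite -tens1 tmap_tens !rmorph1.
move=> x y; move: x; tensor_ind a b; move: y; tensor_ind a' b'.
by rewrite tensM !tmap_tens tensM !rmorphM.
Qed.

HB.instance Definition _ A B A' B' (f : {lrmorphism A -> A'})
  (g : {lrmorphism B -> B'}) :=
  GRing.isMonoidMorphism.Build _ _ (tmap f g) (tmap_monoid_morphism f g).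

Lemma tassoc_monoid_morphism A B C : monoid_morphism (@tassoc k A B C).
Proof.
split=> [|x y]; first by rewrite -!tens1 tassoc_tens.
move: x; tensor_ind t c; move: t; tensor_ind a b.
move: y; tensor_ind t' c'; move: t'; tensor_ind a' b'.
by rewrite !(tensM, tassoc_tens).
Qed.

HB.instance Definition _ A B C :=
  GRing.isMonoidMorphism.Build _ _ _ (tassoc_monoid_morphism A B C).

Lemma tens1_monoid_morphism A B : monoid_morphism (@tens k A B 1).
Proof. by split=> [//|x y]; rewrite tensM mulr1. Qed.

HB.instance Definition _ A B :=
  GRing.isMonoidMorphism.Build _ _ _ (tens1_monoid_morphism A B).

Lemma linear_conj (V : lmodType k) B (f : {linear V -> B}) p q :
  linear (fun v => p * f v * q).
Proof. by move=> a x y; rewrite linearP mulrDr mulrDl -scalerAr -scalerAl. Qed.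

(** Twisting a map inside a tensor factor is twisting outside it; iterating this
    moves F out of each coface map of the twist. *)
Lemma tmap_conj A B C (f g : {linear B -> C}) p q :
  (forall b, g b = p * f b * q) -> forall t,
  tmap (@idfun A) g t = (1 ⊗ p) * tmap idfun f t * (1 ⊗ q).
Proof.
move=> gE; apply: tensor_linear_ext; [exact: linearP | exact: linear_conj|].
by move=> u v; rewrite !tmap_tens !tensM mul1r mulr1 -gE.
Qed.

Variables (A : algType k) (eps : {lrmorphism A -> k^o}).

Lemma tcounitl_monoid_morphism B : monoid_morphism (@tcounitl k A B eps).
Proof.
split=> [|x y]; first by rewrite -tens1 tcounitl_tens rmorph1 scale1r.
move: x; tensor_ind a b; move: y; tensor_ind a' b'.
by rewrite tensM !tcounitl_tens rmorphM -scalerAl -scalerAr scalerA.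
Qed.

Lemma tcounitr_monoid_morphism B : monoid_morphism (@tcounitr k A B eps).
Proof.
split=> [|x y]; first by rewrite -tens1 tcounitr_tens rmorph1 scale1r.
move: x; tensor_ind a b; move: y; tensor_ind a' b'.
by rewrite tensM !tcounitr_tens rmorphM -scalerAl -scalerAr scalerA.
Qed.

HB.instance Definition _ B :=
  GRing.isMonoidMorphism.Build _ _ _ (tcounitl_monoid_morphism B).
HB.instance Definition _ B :=
  GRing.isMonoidMorphism.Build _ _ _ (tcounitr_monoid_morphism B).

End AlgebraMaps.

(** * The two-sided action of A ⊗ A on endomorphisms of A *)

Section TwoSidedAction.
Variables (k : fieldType) (A : algType k).
Implicit Types (S : {linear A -> A}) (p q : (A ⊗ A)%type).

Lemma twist_preantipode_bilin2 S x y a :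
  bilin (fun x' y' : A => x * S (x' * a * y) * y').
Proof.
split=> [y'|x'] c u v; last by rewrite mulrDr -scalerAr.
by rewrite !mulrDl -!scalerAl linearP mulrDr mulrDl -scalerAr -scalerAl.
Qed.

Lemma twist_preantipode_bilin1 S q a :
  bilin (fun x y : A => tlift (fun x' y' => x * S (x' * a * y) * y') q).
Proof.
split=> [y|x] c u v; apply: tlift_fun_linear => x' y'.
  by rewrite !mulrDl -!scalerAl.
by rewrite !mulrDr -!scalerAr linearP mulrDr mulrDl -scalerAr -scalerAl.
Qed.

Lemma twist_preantipode_scale (f g : A -> A) (c : k) p q a :
  (forall b, f b = c *: g b) ->
  twist_preantipode p q f a = c *: twist_preantipode p q g a.
Proof.
move=> fE; rewrite /twist_preantipode /tlift scaler_sumr.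
apply: eq_bigr => xy _; rewrite scaler_sumr; apply: eq_bigr => xy' _.
by rewrite fE -scalerAr -scalerAl.
Qed.

Lemma twist_preantipode_linear_l S q a :
  linear (fun p => twist_preantipode p q S a).
Proof. exact/tlift_linear/twist_preantipode_bilin1. Qed.

Lemma twist_preantipode_linear_r S p a :
  linear (fun q => twist_preantipode p q S a).
Proof.
move=> c q q'; apply: tlift_fun_linear => x y.
exact/tlift_linear/twist_preantipode_bilin2.
Qed.

Lemma twist_preantipode_linear S p q : linear (twist_preantipode p q S).
Proof.
move=> c a a'; apply: tlift_fun_linear => x y; apply: tlift_fun_linear => x' y'.
rewrite !mulrDr mulrDl -scalerAr -scalerAl linearP.
by rewrite mulrDr mulrDl -scalerAr -scalerAl.
Qed.

HB.instance Definition _ S p q := GRing.isLinear.Build k _ _ _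
  (twist_preantipode p q S) (twist_preantipode_linear S p q).

Lemma twist_preantipode_tens S x y x' y' a :
  twist_preantipode (x ⊗ y) (x' ⊗ y') S a = x * S (x' * a * y) * y'.
Proof.
rewrite /twist_preantipode tlift_tens; last exact: twist_preantipode_bilin1.
by rewrite tlift_tens //; exact: twist_preantipode_bilin2.
Qed.

(** With the right argument equal to 1, the action is the expression in the first
    preantipode axiom; twist_preantipode1l is the mirror image for the second. *)
Lemma twist_preantipode1r S p a :
  twist_preantipode p 1 S a = tlift (fun x y => x * S (a * y)) p.
Proof.
apply: tlift_ext => x y; rewrite -tens1 tlift_tens ?mul1r ?mulr1 //.
exact: twist_preantipode_bilin2.
Qed.

Lemma twist_preantipode1l S q a :
  twist_preantipode 1 q S a = tlift (fun x y => S (x * a) * y) q.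
Proof.
rewrite -tens1 /twist_preantipode tlift_tens.
  by apply: tlift_ext => x y; rewrite mulr1 mul1r.
exact: twist_preantipode_bilin1.
Qed.

(** Unfolding twice gives p'1 p1 S(q1 q'1 a p'2 p2) q2 q'2, in which the legs of
    p' and p, and those of q and q', occur in the order of a product: an action
    on the left and an action on the right. *)
Lemma twist_preantipodeM S p q p' q' a :
  twist_preantipode p' q' (twist_preantipode p q S) a =
  twist_preantipode (p' * p) (q * q') S a.
Proof.
move: p'; apply: tensor_linear_ext => [||x1 y1].
- exact: twist_preantipode_linear_l.
- by move=> c u v; rewrite mulrDl -scalerAl twist_preantipode_linear_l.
move: q'; apply: tensor_linear_ext => [||x2 y2].
- exact: twist_preantipode_linear_r.
- by move=> c u v; rewrite mulrDr -scalerAr twist_preantipode_linear_r.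
rewrite twist_preantipode_tens /=.
move: p; apply: tensor_linear_ext => [||x3 y3].
- move=> c u v; rewrite twist_preantipode_linear_l.
  by rewrite mulrDr mulrDl -scalerAr -scalerAl.
- by move=> c u v; rewrite mulrDr -scalerAr twist_preantipode_linear_l.
move: q; apply: tensor_linear_ext => [||x4 y4].
- move=> c u v; rewrite twist_preantipode_linear_r.
  by rewrite mulrDr mulrDl -scalerAr -scalerAl.
- by move=> c u v; rewrite mulrDl -scalerAl twist_preantipode_linear_r.
by rewrite !tensM !twist_preantipode_tens !mulrA.
Qed.

End TwoSidedAction.

(** * The unit inserted behind a tensor *)

(* From here on these maps are known through their values on pure tensors; kept
   transparent, the search for a sum inside them would unfold representatives. *)
Local Opaque tens tmap tassoc tcounitl tcounitr tlift tensor.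

Section TensOne.
Variables (k : fieldType) (A : algType k).
Implicit Types B C : algType k.

(** x ⊗ 1, bracketed to the right: for C = A it is the last coface map on A ⊗ A,
    and for C = A ⊗ A it puts x on the first two factors of a fourfold tensor. *)
Definition tens1r B C (x : (A ⊗ B)%type) : (A ⊗ (B ⊗ C))%type := tassoc (x ⊗ 1).

Lemma tens1r_linear B C : linear (@tens1r B C).
Proof. by move=> c x y; rewrite /tens1r linear_tensl linearP. Qed.

Lemma tens1r_monoid_morphism B C : monoid_morphism (@tens1r B C).
Proof. by split=> [|x y]; rewrite /tens1r ?rmorph1 // -rmorphM tensM mulr1. Qed.

HB.instance Definition _ B C := GRing.isLinear.Build k _ _ _ (@tens1r B C)
  (@tens1r_linear B C).
HB.instance Definition _ B C := GRing.isMonoidMorphism.Build _ _ (@tens1r B C)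
  (@tens1r_monoid_morphism B C).

Lemma tens1r_tens B C (a : A) (b : B) : tens1r C (a ⊗ b) = a ⊗ (b ⊗ 1).
Proof. exact: tassoc_tens. Qed.

Lemma tens1rE B C (t : (A ⊗ B)%type) : tens1r C t = tassoc (t ⊗ 1).
Proof. by []. Qed.

End TensOne.

Local Opaque tens1r.

(** * Contraction of a threefold tensor along an endomorphism *)

Section Contraction.
Variables (k : fieldType) (A : algType k).
Implicit Types (S : {linear A -> A}) (p q : (A ⊗ A)%type).

Definition contract S (w : (A ⊗ (A ⊗ A))%type) : A :=
  tlift (fun x t => tlift (fun y z => x * S y * z) t) w.

Lemma contract_bilin2 S x : bilin (fun y z => x * S y * z).
Proof.
split=> [z|y] c u v; last by rewrite mulrDr -scalerAr.
by rewrite linearP mulrDr mulrDl -scalerAr -scalerAl.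
Qed.

Lemma contract_bilin1 S :
  bilin (fun x (t : (A ⊗ A)%type) => tlift (fun y z => x * S y * z) t).
Proof.
split=> [t|x]; last exact/tlift_linear/contract_bilin2.
by move=> c u v; apply: tlift_fun_linear => y z; rewrite !mulrDl -!scalerAl.
Qed.

HB.instance Definition _ S := GRing.isLinear.Build k _ _ _ (contract S)
  (tlift_linear (contract_bilin1 S)).

Lemma contract_tens S x y z : contract S (x ⊗ (y ⊗ z)) = x * S y * z.
Proof.
rewrite /contract tlift_tens; last exact: contract_bilin1.
by rewrite tlift_tens //; exact: contract_bilin2.
Qed.

(** The inner legs q1 and p2 land next to y inside S, the outer legs p1 and q2
    next to x and z: this is multiplication by 1 ⊗ q before and p ⊗ 1 after. *)
Lemma contract_twist_preantipode S p q w :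
  contract (twist_preantipode p q S) w =
  contract S ((1 ⊗ q) * w * tens1r A p).
Proof.
move: w; tensor_ind x t; move: t; tensor_ind y z; rewrite contract_tens /=.
move: p; apply: tensor_linear_ext => [||x1 y1].
- move=> c u v; rewrite twist_preantipode_linear_l.
  by rewrite mulrDr mulrDl -scalerAr -scalerAl.
- by move=> c u v; rewrite linearP mulrDr -scalerAr linearP.
move: q; apply: tensor_linear_ext => [||x2 y2].
- move=> c u v; rewrite twist_preantipode_linear_r.
  by rewrite mulrDr mulrDl -scalerAr -scalerAl.
- by move=> c u v; rewrite linearP !mulrDl -!scalerAl linearP.
rewrite twist_preantipode_tens tens1r_tens !tensM contract_tens.
by rewrite mul1r mulr1 !mulrA.
Qed.

End Contraction.

(** * Coface maps *)

(** The pentagon for a twist, reduced to a computation with words.  Fij and Fij'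
    stand for F and its inverse on the tensor factors i and j, and Pi for the
    image of Phi under the i-th coface map.  The relations of the second line of
    hypotheses are quasi-coassociativity; in those of the third, an iterated
    coface of F^-1 meets the same one of F, reached along another path; F12
    commutes with F34 because they live on disjoint factors. *)
Lemma twisted_pentagon_word (R : pzRingType)
  (F12 F12' F23 F23' F34 F34' p q r r' s t u u' v w y y' P0 P1 P2 P3 P4 : R) :
  P3 * P1 = P0 * P2 * P4 ->
  q * P0 = P0 * v -> w * P4 = P4 * s ->
  r * r' = 1 -> u * u' = 1 -> y * y' = 1 ->
  F12' * F12 = 1 -> F23' * F23 = 1 -> F34' * F34 = 1 -> F12 * F34 = F34 * F12 ->
  F34 * (p * q * P3 * r * F12') * F34' * (F12 * (F34 * r' * P1 * s * t) * F12') =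
  F34 * p * P0 * u * F23' * (F23 * (u' * v * P2 * w * y) * F23') *
    (F23 * y' * P4 * t * F12').
Proof.
move=> pent qP wP rK uK yK F12K F23K F34K FC.
have cancel a b : a * b = 1 -> forall c, a * (b * c) = c :> R.
  by move=> ab c; rewrite mulrA ab mul1r.
have FK : F12' * (F34' * (F12 * F34)) = 1 by rewrite FC (cancel _ _ F34K).
have qP' c : q * (P0 * c) = P0 * (v * c) by rewrite mulrA qP -mulrA.
have wP' c : w * (P4 * c) = P4 * (s * c) by rewrite mulrA wP -mulrA.
have pent' c : P3 * (P1 * c) = P0 * (P2 * (P4 * c)).
  by rewrite mulrA pent -!mulrA.
have FK' c : F12' * (F34' * (F12 * (F34 * c))) = c.
  by rewrite -[in RHS](mul1r c) -FK -!mulrA.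
rewrite -!mulrA FK' (cancel _ _ rK) pent' qP'.
by rewrite !(cancel _ _ F23K) (cancel _ _ uK) (cancel _ _ yK) wP'.
Qed.

Section QuasiBialgebra.
Variables (k : fieldType) (A : algType k).
Variable Delta : {lrmorphism A -> (A ⊗ A)%type}.
Implicit Types B C : algType k.

(** Delta on the first tensor factor, the rest of the tensor being arbitrary, so
    that one map serves on A ⊗ A and on A ⊗ (A ⊗ A). *)
Definition comult1 B : (A ⊗ B)%type -> (A ⊗ (A ⊗ B))%type :=
  @tassoc k A A B \o tmap Delta idfun.

HB.instance Definition _ B :=
  GRing.LRMorphism.copy (@comult1 B) (@tassoc k A A B \o tmap Delta idfun).

Lemma comult1_tens B a (b : B) : comult1 (a ⊗ b) = tassoc (Delta a ⊗ b).
Proof. by rewrite /comult1 /= tmap_tens. Qed.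

Local Opaque comult1.

(* On A ⊗ A: Delta on the last factor.  On threefold tensors: Delta on the third
   and on the second factor, and the unit inserted in fourth position. *)
Local Notation comult2 := (tmap idfun Delta).
Local Notation comult3 := (tmap idfun comult2).
Local Notation comult2of3 := (tmap idfun (@comult1 A)).
Local Notation tens1r3 x := (tmap idfun (@tassoc k A A A) (tens1r A x)).

Lemma tens1r3_tens (a b c : A) : tens1r3 (a ⊗ (b ⊗ c)) = a ⊗ (b ⊗ (c ⊗ 1)).
Proof. by rewrite tens1r_tens tmap_tens /= tassoc_tens. Qed.

Lemma tens1r3_tassoc (t : (A ⊗ A)%type) b :
  tens1r3 (tassoc (t ⊗ b)) = tassoc (t ⊗ (b ⊗ 1)).
Proof. by move: t; tensor_ind u v; rewrite !tassoc_tens tens1r3_tens. Qed.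

Implicit Types x y : (A ⊗ A)%type.

Lemma comult3_tens1r x : comult3 (tens1r A x) = tens1r (A ⊗ A)%type x.
Proof.
move: x; tensor_ind a b.
by rewrite !tens1r_tens tmap_tens /= tmap_tens /= rmorph1.
Qed.

Lemma comult1_tens1 B (y : B) : comult1 (1 ⊗ y) = 1 ⊗ (1 ⊗ y).
Proof. by rewrite comult1_tens rmorph1 tassoc_tens. Qed.

Lemma comult1_comult2 x : comult1 (comult2 x) = comult3 (comult1 x).
Proof.
move: x; tensor_ind a b; rewrite tmap_tens !comult1_tens.
by move: (Delta a); tensor_ind u v; rewrite !tassoc_tens tmap_tens /= tmap_tens.
Qed.

Lemma comult2of3_tens1r x : comult2of3 (tens1r A x) = tens1r3 (comult2 x).
Proof.
move: x; tensor_ind a b; rewrite tens1r_tens !tmap_tens /= comult1_tens.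
by rewrite tens1r_tens tmap_tens.
Qed.

Lemma tens1r3_tens1 x : tens1r3 ((1 : A) ⊗ x) = 1 ⊗ tens1r A x.
Proof. by rewrite tens1r_tens tmap_tens /=. Qed.

Lemma tens1r3_comult1 x : tens1r3 (comult1 x) = comult1 (tens1r A x).
Proof.
by move: x; tensor_ind a b; rewrite tens1r_tens !comult1_tens tens1r3_tassoc.
Qed.

Lemma tens1r3_tens1r x : tens1r3 (tens1r A x) = tens1r (A ⊗ A)%type x.
Proof.
move: x; tensor_ind a b.
by rewrite !tens1r_tens tmap_tens /= tassoc_tens.
Qed.

Lemma tens1r_comm x y :
  tens1r (A ⊗ A)%type x * (1 ⊗ (1 ⊗ y)) = 1 ⊗ (1 ⊗ y) * tens1r (A ⊗ A)%type x.
Proof.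
by move: x; tensor_ind a b; rewrite tens1r_tens !tensM !mulr1 !mul1r.
Qed.

(** * Coface maps and the reassociator *)

Variables (eps : {lrmorphism A -> k^o}) (Phi : (A ⊗ (A ⊗ A))%type).
Hypothesis quasiA : quasi_bialgebra Delta eps Phi.

(** The two coface compositions that differ by a conjugation: applying Delta
    twice on the last factor, and twice on the first one. *)
Lemma comult3_comult2 x :
  comult3 (comult2 x) * (1 ⊗ Phi) = (1 ⊗ Phi) * comult2of3 (comult2 x).
Proof.
move: x; apply: tensor_linear_ext => [c x y|c x y|a b].
- by rewrite 2!linearP /= mulrDl -scalerAl.
- by rewrite 2!linearP /= mulrDr -scalerAr.
- by rewrite !tmap_tens !tensM mulr1 mul1r (quasi_coassociativity quasiA).
Qed.

Lemma comult2of3_tassoc (t : (A ⊗ A)%type) b :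
  comult2of3 (tassoc (t ⊗ b)) =
  tmap idfun (@tassoc k A A A) (tassoc (comult2 t ⊗ b)).
Proof.
move: t; tensor_ind u v.
by rewrite !tassoc_tens !tmap_tens /= comult1_tens !tassoc_tens tmap_tens.
Qed.

Lemma comult1_tassoc (t : (A ⊗ A)%type) b :
  comult1 (tassoc (t ⊗ b)) =
  tmap idfun (@tassoc k A A A) (tassoc (comult1 t ⊗ b)).
Proof.
move: t; tensor_ind u v; rewrite !(tassoc_tens, comult1_tens).
move: (Delta u); tensor_ind u1 u2.
by rewrite !tassoc_tens tmap_tens /= tassoc_tens.
Qed.

Lemma comult2of3_comult1 x :
  comult2of3 (comult1 x) * tens1r3 Phi = tens1r3 Phi * comult1 (comult1 x).
Proof.
move: x; tensor_ind a b; rewrite comult1_tens comult2of3_tassoc comult1_tassoc.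
rewrite tens1rE -!rmorphM /= !tensM (quasi_coassociativity quasiA).
by rewrite mulr1 mul1r.
Qed.

(** * The twisted quasi-bialgebra *)

Variables F Finv : (A ⊗ A)%type.

Local Notation Delta_F := (twist_comult F Finv Delta).
Local Notation Phi_F := (twist_reassociator F Finv Delta Phi).

HB.instance Definition _ := GRing.isLinear.Build k _ _ _
  Delta_F (linear_conj Delta F Finv).

Lemma twist_comult1 (B : algType k) t :
  (@tassoc k A A B) (tmap Delta_F idfun t) =
  tens1r B F * comult1 t * tens1r B Finv.
Proof.
move: t; apply: tensor_linear_ext; [|exact: linear_conj|].
  by move=> c x y; rewrite 2!linearP.
move=> a b; rewrite tmap_tens /= comult1_tens !tens1rE -!rmorphM !tensM.
by rewrite mul1r mulr1.
Qed.

Hypothesis gaugeF : gauge_transformation eps F Finv.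

Let FK : F * Finv = 1. Proof. by case: gaugeF. Qed.
Let KF : Finv * F = 1. Proof. by case: gaugeF. Qed.

Lemma rmorph_KV (B : pzRingType) (f : {rmorphism (A ⊗ A)%type -> B}) z :
  f F * (f Finv * z) = z.
Proof. by rewrite mulrA -rmorphM FK rmorph1 mul1r. Qed.

Lemma rmorph_VK (B : pzRingType) (f : {rmorphism (A ⊗ A)%type -> B}) z :
  f Finv * (f F * z) = z.
Proof. by rewrite mulrA -rmorphM KF rmorph1 mul1r. Qed.

Lemma counit_inv (B : pzRingType) (f : {rmorphism (A ⊗ A)%type -> B}) :
  f F = 1 -> f Finv = 1.
Proof. by move=> f1; rewrite -[RHS](rmorph1 f) -FK rmorphM f1 mul1r. Qed.

Lemma twist_reassociatorE :
  Phi_F = (1 ⊗ F) * comult2 F * Phi * comult1 Finv * tens1r A Finv.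
Proof. by []. Qed.

Lemma twist_comult_algebra_map : algebra_map Delta_F.
Proof.
split; first exact: linearP.
split=> [|x y]; rewrite /twist_comult ?rmorph1 ?mulr1 //.
by rewrite rmorphM -!mulrA (mulrA Finv) KF mul1r.
Qed.

Lemma twist_reassociator_invertible : invertible Phi_F.
Proof.
have [Psi [PK KP]] := reassociator_invertible quasiA.
rewrite twist_reassociatorE.
exists (tens1r A F * comult1 F * Psi * comult2 Finv * (1 ⊗ Finv)).
split; rewrite -!mulrA !rmorph_VK ?(mulrA Phi) ?(mulrA Psi) ?PK ?KP mul1r.
- by rewrite rmorph_KV -rmorphM FK rmorph1.
- by rewrite rmorph_KV -rmorphM FK rmorph1.
Qed.

Lemma twist_coassoc a :
  tmap idfun Delta_F (Delta_F a) * Phi_F =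
  Phi_F * tassoc (tmap Delta_F idfun (Delta_F a)).
Proof.
rewrite twist_comult1 (tmap_conj (q := Finv) (p := F) (f := Delta)) //.
rewrite twist_reassociatorE /twist_comult !rmorphM -!mulrA !rmorph_VK.
do 2!congr (_ * _); rewrite !mulrA; congr (_ * _ * _).
exact: quasi_coassociativity quasiA a.
Qed.

Lemma counitl_tens1 (B : algType k) (y : B) : tcounitl eps (1 ⊗ y) = y.
Proof. by rewrite tcounitl_tens rmorph1 scale1r. Qed.

Lemma counitl_comult2 x : tcounitl eps (comult2 x) = Delta (tcounitl eps x).
Proof.
by move: x; tensor_ind a b; rewrite tmap_tens !tcounitl_tens linearZ.
Qed.

Lemma counitl_tassoc (B : algType k) x (b : B) :
  tcounitl eps (tassoc (x ⊗ b)) = tcounitl eps x ⊗ b.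
Proof.
by move: x; tensor_ind u v; rewrite tassoc_tens !tcounitl_tens tensZl.
Qed.

Lemma counitl_comult1 x : tcounitl eps (comult1 x) = x.
Proof.
move: x; tensor_ind a b.
by rewrite comult1_tens counitl_tassoc (left_counit quasiA).
Qed.

Lemma counitl_tens1r x : tcounitl eps (tens1r A x) = tcounitl eps x ⊗ 1.
Proof. by rewrite tens1rE counitl_tassoc. Qed.

Lemma twist_counit1 : tcounitl eps Phi_F = 1 ⊗ 1.
Proof.
rewrite twist_reassociatorE !rmorphM /= (reassociator_counit1 quasiA) mulr1.
rewrite counitl_tens1 counitl_comult2 counitl_comult1 counitl_tens1r.
have eF := gauge_counitl gaugeF.
by rewrite (counit_inv eF) eF rmorph1 tens1 !mulr1 FK.
Qed.

Local Notation counit2 := (tmap (@idfun A) (tcounitl eps)).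

Lemma counit2_tassoc x (b : A) :
  counit2 (tassoc (x ⊗ b)) = tcounitr eps x ⊗ b.
Proof.
move: x; tensor_ind u v; rewrite tassoc_tens tmap_tens /= tcounitl_tens.
by rewrite tcounitr_tens tensZl linearZ.
Qed.

Lemma counit2_comult1 x : counit2 (comult1 x) = x.
Proof.
move: x; tensor_ind a b.
by rewrite comult1_tens counit2_tassoc (right_counit quasiA).
Qed.

Lemma counit2_comult2 x : counit2 (comult2 x) = x.
Proof.
move: x; tensor_ind a b; rewrite !tmap_tens /=.
by rewrite (left_counit quasiA).
Qed.

Lemma twist_counit2 : counit2 Phi_F = 1 ⊗ 1.
Proof.
rewrite twist_reassociatorE !rmorphM /= (reassociator_counit2 quasiA) mulr1.
rewrite counit2_comult2 counit2_comult1 tens1rE counit2_tassoc tmap_tens /=.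
rewrite (counit_inv (gauge_counitr gaugeF)) (gauge_counitl gaugeF).
by rewrite tens1 mul1r mulr1 FK.
Qed.

Local Notation counit3 := (tmap (@idfun A) (tcounitr eps)).

Lemma counit3_tassoc x (b : A) :
  counit3 (tassoc (x ⊗ b)) = (eps b : k) *: x.
Proof.
move: x; tensor_ind u v; rewrite tassoc_tens tmap_tens /= tcounitr_tens.
by rewrite linearZ.
Qed.

Lemma counit3_comult1 x : counit3 (comult1 x) = Delta (tcounitr eps x).
Proof.
move: x; tensor_ind a b.
by rewrite comult1_tens counit3_tassoc tcounitr_tens linearZ.
Qed.

Lemma counit3_comult2 x : counit3 (comult2 x) = x.
Proof.
move: x; tensor_ind a b; rewrite !tmap_tens /=.
by rewrite (right_counit quasiA).
Qed.

Lemma twist_counit3 : counit3 Phi_F = 1 ⊗ 1.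
Proof.
rewrite twist_reassociatorE !rmorphM /= (reassociator_counit3 quasiA) mulr1.
rewrite counit3_comult2 counit3_comult1 tens1rE counit3_tassoc tmap_tens /=.
rewrite (counit_inv (gauge_counitr gaugeF)) (gauge_counitr gaugeF).
by rewrite !rmorph1 scale1r mulr1 mul1r FK.
Qed.

Lemma twist_left_counit a : tcounitl eps (Delta_F a) = a.
Proof.
rewrite /twist_comult !rmorphM /= (left_counit quasiA).
have eF := gauge_counitl gaugeF.
by rewrite (counit_inv eF) eF mul1r mulr1.
Qed.

Lemma twist_right_counit a : tcounitr eps (Delta_F a) = a.
Proof.
rewrite /twist_comult !rmorphM /= (right_counit quasiA).
have eF := gauge_counitr gaugeF.
by rewrite (counit_inv eF) eF mul1r mulr1.
Qed.

Lemma comult3_twist t :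
  tmap (@idfun A) (tmap (@idfun A) Delta_F) t =
  (1 ⊗ (1 ⊗ F)) * comult3 t * (1 ⊗ (1 ⊗ Finv)).
Proof.
apply: tmap_conj => u; exact: tmap_conj.
Qed.

Lemma comult2of3_twist t :
  tmap (@idfun A) (@tassoc k A A A \o tmap Delta_F idfun) t =
  (1 ⊗ tens1r A F) * comult2of3 t * (1 ⊗ tens1r A Finv).
Proof. by apply: tmap_conj => u; exact: twist_comult1. Qed.

(* The five images of the twisted reassociator, with iterated cofaces of F and
   its inverse brought to a common form so that equal ones meet literally. *)
Let comult3_reassociator :
  comult3 Phi_F = (1 ⊗ comult2 F) * comult3 (comult2 F) * comult3 Phi *
    comult3 (comult1 Finv) * tens1r (A ⊗ A)%type Finv.
Proof.
by rewrite twist_reassociatorE !rmorphM /= comult3_tens1r tmap_tens.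
Qed.

Let comult1_reassociator :
  comult1 Phi_F = (1 ⊗ (1 ⊗ F)) * comult3 (comult1 F) * comult1 Phi *
    comult1 (comult1 Finv) * comult1 (tens1r A Finv).
Proof.
by rewrite twist_reassociatorE !rmorphM /= comult1_comult2 comult1_tens1.
Qed.

Let tens1_reassociator :
  1 ⊗ Phi_F = (1 ⊗ (1 ⊗ F)) * (1 ⊗ comult2 F) * (1 ⊗ Phi) *
    (1 ⊗ comult1 Finv) * (1 ⊗ tens1r A Finv) :> (A ⊗ (A ⊗ (A ⊗ A)))%type.
Proof. by rewrite twist_reassociatorE !rmorphM. Qed.

Let comult2of3_reassociator :
  comult2of3 Phi_F = (1 ⊗ comult1 F) * comult2of3 (comult2 F) * comult2of3 Phi *
    comult2of3 (comult1 Finv) * tens1r3 (comult2 Finv).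
Proof.
by rewrite twist_reassociatorE !rmorphM /= comult2of3_tens1r tmap_tens.
Qed.

Let tens1r3_reassociator :
  tens1r3 Phi_F = (1 ⊗ tens1r A F) * tens1r3 (comult2 F) * tens1r3 Phi *
    comult1 (tens1r A Finv) * tens1r (A ⊗ A)%type Finv.
Proof.
rewrite twist_reassociatorE !rmorphM /=.
by rewrite tens1r3_tens1 tens1r3_comult1 tens1r3_tens1r.
Qed.

Lemma twist_pentagon :
  tmap idfun (tmap idfun Delta_F) Phi_F * tassoc (tmap Delta_F idfun Phi_F) =
  (1 ⊗ Phi_F) * tmap idfun (@tassoc k A A A \o tmap Delta_F idfun) Phi_F
      * tmap idfun (@tassoc _ _ _ _) (tassoc (Phi_F ⊗ 1)).
Proof.
rewrite comult3_twist twist_comult1 comult2of3_twist -tens1rE.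
rewrite comult3_reassociator comult1_reassociator tens1_reassociator.
rewrite comult2of3_reassociator tens1r3_reassociator.
apply: twisted_pentagon_word.
- exact: reassociator_pentagon quasiA.
- exact: comult3_comult2.
- exact: comult2of3_comult1.
- by rewrite -!rmorphM KF !rmorph1.
- by rewrite -!rmorphM KF !rmorph1.
- by rewrite -!rmorphM KF !rmorph1.
- by rewrite -!rmorphM KF !rmorph1.
- by rewrite -!rmorphM KF !rmorph1.
- by rewrite -!rmorphM KF !rmorph1.
- exact: tens1r_comm.
Qed.

Lemma twist_is_quasi_bialgebra : quasi_bialgebra Delta_F eps Phi_F.
Proof.
split.
- exact: twist_comult_algebra_map.
- exact: counit_algebra_map quasiA.
- exact: twist_reassociator_invertible.
- exact: twist_pentagon.
- exact: twist_counit1.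
- exact: twist_counit2.
- exact: twist_counit3.
- exact: twist_coassoc.
- exact: twist_left_counit.
- exact: twist_right_counit.
Qed.

(** * The twisted preantipode *)

Variable S : {linear A -> A}.
Hypothesis preS : preantipode Delta eps Phi S.

(** Both legs of Delta(p2) end up around y, one inside and one outside S, where
    the second preantipode axiom collapses them; contract_comult1 is the mirror
    image for the first axiom. *)
Lemma contract_comult2 p w :
  contract S (tmap idfun Delta p * w) = tcounitr eps p * contract S w.
Proof.
move: p; tensor_ind a b; rewrite tmap_tens tcounitr_tens.
move: w; tensor_ind x t; move: t; tensor_ind y z.
rewrite contract_tens.
have -> t : contract S ((a ⊗ t) * (x ⊗ (y ⊗ z))) =
    a * x * twist_preantipode 1 t S y * z.
  move: t; apply: tensor_linear_ext => [||u v].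
  - by move=> c u v; rewrite linearP mulrDl -scalerAl linearP.
  - move=> c u v; rewrite twist_preantipode_linear_r.
    by rewrite mulrDr mulrDl -scalerAr -scalerAl.
  rewrite -[1]tens1 !tensM contract_tens twist_preantipode_tens.
  by rewrite mul1r mulr1 !mulrA.
rewrite twist_preantipode1l (preantipoder preS).
by rewrite -scalerAr -!scalerAl !mulrA.
Qed.

Lemma contract_comult1 w p :
  contract S (w * comult1 p) = contract S w * tcounitl eps p.
Proof.
move: p; tensor_ind a b; rewrite comult1_tens tcounitl_tens.
move: w; tensor_ind x t; move: t; tensor_ind y z.
rewrite contract_tens.
have -> t : contract S ((x ⊗ (y ⊗ z)) * tassoc (t ⊗ b)) =
    x * twist_preantipode t 1 S y * (z * b).
  move: t; apply: tensor_linear_ext => [||u v].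
  - by move=> c u v; rewrite linear_tensl linearP mulrDr -scalerAr linearP.
  - move=> c u v; rewrite twist_preantipode_linear_l.
    by rewrite mulrDr mulrDl -scalerAr -scalerAl.
  rewrite tassoc_tens -[1]tens1 !tensM contract_tens twist_preantipode_tens.
  by rewrite mul1r mulr1 !mulrA.
rewrite twist_preantipode1r (preantipodel preS).
by rewrite -!scalerAr -!scalerAl !mulrA.
Qed.

Local Notation S_F := (twist_preantipode F Finv S).

Lemma twist_is_preantipode : preantipode Delta_F eps Phi_F S_F.
Proof.
split; first exact: linearP.
- move=> a b; rewrite -twist_preantipode1r twist_preantipodeM mulr1.
  (* F Delta(a) . S . F^-1 is split as F . (Delta(a) . S) . F^-1. *)
  rewrite /twist_comult -mulrA KF mulr1 -[X in twist_preantipode _ X](mul1r Finv).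
  rewrite -twist_preantipodeM; apply: twist_preantipode_scale => c.
  by rewrite twist_preantipode1r (preantipodel preS).
- move=> a b; rewrite -twist_preantipode1l twist_preantipodeM mul1r.
  rewrite /twist_comult !mulrA KF mul1r -{1}(mulr1 F).
  rewrite -twist_preantipodeM; apply: twist_preantipode_scale => c.
  by rewrite twist_preantipode1l (preantipoder preS).
rewrite -[LHS]/(contract S_F _) contract_twist_preantipode.
rewrite twist_reassociatorE -!mulrA -rmorphM KF rmorph1 mulr1.
rewrite mulrA -rmorphM KF rmorph1 mul1r contract_comult2 contract_comult1.
rewrite (gauge_counitr gaugeF) (counit_inv (gauge_counitl gaugeF)).
by rewrite mul1r mulr1; exact: preantipode_reassociator preS.
Qed.

End QuasiBialgebra.

Theorem proposition3p17 (k : fieldType) (A : algType k)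
    (Delta : A -> A ⊗ A) (eps : A -> k) (Phi : A ⊗ (A ⊗ A)) (S : A -> A)
    (F Finv : A ⊗ A) :
  quasi_bialgebra Delta eps Phi ->
  preantipode Delta eps Phi S ->
  gauge_transformation eps F Finv ->
  quasi_bialgebra (twist_comult F Finv Delta) eps
    (twist_reassociator F Finv Delta Phi) /\
  preantipode (twist_comult F Finv Delta) eps
    (twist_reassociator F Finv Delta Phi) (twist_preantipode F Finv S).
Proof.
move=> quasiA preS gaugeF.
have [linD mulD] := comult_algebra_map quasiA.
have [line mule] := counit_algebra_map quasiA.
pose D : {lrmorphism A -> (A ⊗ A)%type} := HB.pack Delta
  (GRing.isLinear.Build k _ _ _ Delta linD)
  (GRing.isMonoidMorphism.Build _ _ Delta mulD).
pose e : {lrmorphism A -> k^o} := HB.pack (eps : A -> k^o)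
  (GRing.isLinear.Build k _ _ _ (eps : A -> k^o) line)
  (GRing.isMonoidMorphism.Build _ _ (eps : A -> k^o) mule).
pose S' : {linear A -> A} := HB.pack S
  (GRing.isLinear.Build k _ _ _ S (preantipode_linear preS)).
split; first exact: (@twist_is_quasi_bialgebra k A D e).
exact: (@twist_is_preantipode k A D e Phi F Finv gaugeF S' preS).
Qed.
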